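(* There is an absolute constant $C$ such that every finite multigraph $G$ on $n\ge 2$ vertices satisfies $$\operatorname{bn}(G)\le C\log n.$$
   Context: Multigraphs may have loops and parallel edges; a loop contributes two to the degree of its incident vertex. $\log$ is the base-$2$ logarithm. For a finite multigraph $G=(V,E)$, the cycle space $\mathcal Z(G)\subseteq\mathbb F_2^{E}$ is the vector space of Eulerian edge sets (edge sets in which every vertex has even degree), with symmetric difference as addition. A cycle basis of $G$ is a basis of $\mathcal Z(G)$ over $\mathbb F_2$. For a family $\mathcal B$ of edge sets and $e\in E$, the charge of $e$ is $\operatorname{ch}_{\mathcal B}(e)=|\{B\in\mathcal B: e\in B\}|$, and the congestion of $\mathcal B$ is $\operatorname{cong}(\mathcal B)=\max_{e\in E}\operatorname{ch}_{\mathcal B}(e)$, with $\operatorname{cong}(\mathcal B)=0$ if $E=\varnothing$. The basis number of $G$ is $\operatorname{bn}(G)=\min\{\operatorname{cong}(\mathcal B):\mathcal B\text{ is a cycle basis of }G\}$. *)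

(* Defs.v *)
From HB Require Import structures.
From mathcomp Require Import all_boot all_order all_algebra.
From mathcomp Require Import reals exp.

Set Implicit Arguments.
Unset Strict Implicit.
Unset Printing Implicit Defensive.

Import Order.TTheory GRing.Theory Num.Theory.

Local Open Scope ring_scope.

(* The order of the two ends of an edge is a bookkeeping artefact: everything
   below is invariant under swapping src and tgt. A loop has src e = tgt e. *)
Record multigraph := Multigraph {
  vertex : finType;
  edge : finType;
  src : edge -> vertex;
  tgt : edge -> vertex
}.

Section CycleSpace.
Variable G : multigraph.
Implicit Types (F B : {set edge G}) (v : vertex G) (e : edge G).

Definition incidence e v : nat := (src e == v) + (tgt e == v).

Definition degree F v : nat := \sum_(e in F) incidence e v.

Definition eulerian F : bool := [forall v, ~~ odd (degree F v)].

Definition edge_space := {ffun edge G -> ('F_2)^o}.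

Definition charvec F : edge_space := [ffun e => (e \in F)%:R].

Definition supp (x : edge_space) : {set edge G} := [set e | x e != 0].

(* Generated by the Eulerian edge sets, and containing no other edge set:
   see mem_cycle_space. *)
Definition cycle_space : {vspace edge_space} :=
  <<[seq charvec F | F : {set edge G} in eulerian]>>%VS.

Definition cycle_basis (BB : {set {set edge G}}) : bool :=
  basis_of cycle_space [seq charvec B | B in BB].

Definition charge (BB : {set {set edge G}}) e : nat :=
  #|[set B in BB | e \in B]|.

Definition congestion (BB : {set {set edge G}}) : nat :=
  \max_(e : edge G) charge BB e.

Lemma F2_natr (n : nat) : (n%:R == 0 :> 'F_2) = ~~ odd n.
Proof.
by rewrite -Zp_nat_mod // modn2; case: odd.
Qed.

Lemma charvecK : cancel charvec supp.
Proof.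
by move=> F; apply/setP=> e; rewrite inE ffunE; case: (e \in F).
Qed.

Lemma suppK : cancel supp charvec.
Proof.
move=> x; apply/ffunP=> e; rewrite ffunE inE.
by case: (x e) => [[|[|//]] lt] /=; apply/val_inj.
Qed.

Lemma charvec_symdiff F B :
  charvec ((F :\: B) :|: (B :\: F)) = charvec F + charvec B.
Proof.
apply/ffunP=> e; rewrite !ffunE !inE.
by case: (e \in F); case: (e \in B); apply/val_inj.
Qed.

Definition boundary (x : edge_space) : {ffun vertex G -> ('F_2)^o} :=
  [ffun v => \sum_e x e * (incidence e v)%:R].

Lemma boundary_is_linear : linear boundary.
Proof.
move=> a x y; apply/ffunP=> v; rewrite !ffunE /GRing.scale /= mulr_sumr.
rewrite -big_split /=; apply: eq_bigr => e _.
by rewrite !ffunE mulrDl mulrA.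
Qed.

HB.instance Definition _ :=
  GRing.isLinear.Build 'F_2 edge_space {ffun vertex G -> ('F_2)^o} _
    boundary boundary_is_linear.

Lemma boundary_charvec F : (boundary (charvec F) == 0) = eulerian F.
Proof.
have bE v : boundary (charvec F) v = (degree F v)%:R.
  rewrite ffunE natr_sum [RHS]big_mkcond /=; apply: eq_bigr => e _.
  by rewrite ffunE; case: (e \in F); rewrite ?mul1r ?mul0r.
apply/eqP/forallP => [b0 v|eF].
  by rewrite -F2_natr -bE b0 ffunE.
by apply/ffunP=> v; rewrite bE ffunE; apply/eqP; rewrite F2_natr.
Qed.

Lemma mem_cycle_space F : (charvec F \in cycle_space) = eulerian F.
Proof.
apply/idP/idP => [|eF]; last by apply/memv_span/image_f.
suff /subvP sub : (cycle_space <= lker (linfun boundary))%VS.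
  by move/sub; rewrite memv_ker lfunE boundary_charvec.
apply/span_subvP => _ /imageP[B eB ->].
by rewrite memv_ker lfunE boundary_charvec.
Qed.

Lemma exists_cycle_basis : exists BB, cycle_basis BB.
Proof.
exists [set supp x | x in vbasis cycle_space].
have bas := vbasisP cycle_space.
rewrite /cycle_basis (perm_basis (Y := vbasis cycle_space)) //.
apply: uniq_perm.
- by rewrite map_inj_uniq ?enum_uniq //; exact: can_inj charvecK.
- exact: free_uniq (basis_free bas).
move=> x; apply/imageP/idP => [[_ /imsetP[y yb ->] ->]|xb].
  by rewrite suppK.
by exists (supp x); rewrite ?suppK //; apply: imset_f.
Qed.

Definition has_congestion (k : nat) : bool :=
  [exists BB, cycle_basis BB && (congestion BB == k)].

Lemma exists_congestion : exists k, has_congestion k.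
Proof.
have [BB bBB] := exists_cycle_basis.
by exists (congestion BB); apply/existsP; exists BB; rewrite bBB eqxx.
Qed.

Definition basis_number : nat := ex_minn exists_congestion.

End CycleSpace.

Definition log2 (R : realType) (x : R) : R := ln x / ln 2.

(* Main.v *)
Require Import Defs.
From mathcomp Require Import all_boot all_order all_algebra.
From mathcomp Require Import perm reals exp zify.

Set Implicit Arguments.
Unset Strict Implicit.
Unset Printing Implicit Defensive.

Import Order.TTheory GRing.Theory Num.Theory.
Local Open Scope ring_scope.

(** A basis of small congestion is found by local search.  Take a basis B of the
    cycle space minimising the potential [sum over e of 2^(ch_B e)] and use the
    weights [w e := 2^(ch_B e)].  If B' is any other basis, the two are matched
    by a bijection along which single exchanges keep a basis
    ([basis_exchange_perm]); none of these exchanges lowers the potential, and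
    adding up these inequalities gives

      sum of w e * ch_B e  <=  2 * sum of w e * ch_B' e.

    So, if for every weighting w some basis B' has total weight at most
    K times the weight of all edges, the w-average of ch_B is at most 2K.  As w
    grows exponentially with ch_B, an average of order K forces a maximum of
    order K + log(number of edges): this is [light_bases_congestion], which
    holds for every binary code.

    It remains to provide, for every weighting of the edges, a cycle basis of
    weight O(log n) times the total weight ([exists_light_family]).  Its cycles
    are found one by one.  If some cycle has O(log n) edges, add it to the
    family and delete its heaviest edge: the weight of the cycle is paid for by
    the deleted edge, and the other cycles can be moved off that edge.  If there
    is no such cycle, some vertex has degree 1 or 2, because balls in a graph
    with minimum degree 3 and no short cycle double at every step
    ([vertices_ge_exp]).  Contracting an edge at that vertex, and handing its
    weight over to the other edge there (if any), keeps the cycle space up to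
    isomorphism and does not raise the total weight.

    Since the logarithm of the number of edges enters the bound, this is applied
    to a subgraph with one edge from each parallel class, which has at most n^2
    edges.  The other cycles are generated by two-edge cycles joining
    consecutive edges of a parallel class, at an additional charge of 2. *)

(** * Local search for bases of low congestion *)

(** Some term of the Leibniz expansion of the (nonzero) determinant of the change
    of basis does not vanish; its permutation is the required matching. *)
Lemma basis_exchange_perm (K : fieldType) (vT : vectType K) (U : {vspace vT})
    (d : nat) (b c : d.-tuple vT) :
  basis_of U b -> basis_of U c ->
  exists s : 'S_d, forall j,
    basis_of U [tuple if i == s j then tnth c j else tnth b i | i < d].
Proof.
move=> bU cU.
have memb i : tnth b i \in U by apply: (basis_mem bU); apply: mem_tnth.
have memc i : tnth c i \in U by apply: (basis_mem cU); apply: mem_tnth.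
pose A := \matrix_(j < d, i < d) coord b i (tnth c j).
pose C := \matrix_(i < d, j < d) coord c j (tnth b i).
have cE j : tnth c j = \sum_i A j i *: tnth b i.
  rewrite {1}(coord_basis bU (memc j)); apply: eq_bigr => i _.
  by rewrite mxE (tnth_nth 0 b).
have AC : A *m C = 1%:M.
  apply/matrixP=> j k; rewrite !mxE.
  rewrite -(coord_free j k (basis_free cU)) -(tnth_nth 0 c j) cE linear_sum.
  by apply: eq_bigr => i _; rewrite linearZ /= !mxE.
have detA : \det A != 0.
  apply/eqP=> A0; have := det_mulmx A C.
  by rewrite A0 mul0r AC det1 => /eqP; rewrite oner_eq0.
have [s sA] : exists s : 'S_d, \prod_j A j (s j) != 0.
  apply/existsP; apply: contraNT detA => /existsPn s0.
  rewrite /determinant big1 // => s _.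
  by move/negbNE/eqP: (s0 s) => ->; rewrite mulr0.
exists s => j; set b' := mktuple _.
rewrite basisEdim size_tuple (size_basis bU) leqnn andbT.
have Asj : A j (s j) != 0 by move/prodf_neq0: sA => /(_ j isT).
have b'E i : (if i == s j then tnth c j else tnth b i) \in <<b'>>%VS.
  by rewrite -(tnth_mktuple (fun i => if i == s j then tnth c j else tnth b i));
     apply/memv_span/mem_tnth.
rewrite -(span_basis bU); apply/span_subvP => _ /tnthP[i ->].
case: (eqVneq i (s j)) => [->|ne]; last by have := b'E i; rewrite (negPf ne).
rewrite -[tnth b _]scale1r -(mulVf Asj) -scalerA memvZ //.
have -> : A j (s j) *: tnth b (s j) =
    tnth c j - \sum_(i | i != s j) A j i *: tnth b i.
  by rewrite cE (bigD1 (s j)) //= addrK.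
apply: memvB; first by have := b'E (s j); rewrite eqxx.
by apply: memv_suml => k ne'; apply: memvZ; have := b'E k; rewrite (negPf ne').
Qed.

Lemma span_free_subseq (K : fieldType) (vT : vectType K) (s : seq vT) :
  exists u, [/\ subseq u s, free u & <<u>>%VS = <<s>>%VS].
Proof.
elim: s => [|x s [u [us fu eu]]]; first by exists [::]; rewrite nil_free.
case xu: (x \in <<u>>%VS).
  exists u; split=> //; first exact: subseq_trans us (subseq_cons s x).
  by rewrite span_cons -eu; apply/esym/addv_idPr.
exists (x :: u); rewrite free_cons xu fu; split=> //; first by rewrite /= eqxx.
by rewrite !span_cons eu.
Qed.

(** Terms with [h e <= L] lower the sum of [2 ^ h e * (h e - L)] by at most
    [L * 2 ^ L] each, so a single large [h e] cannot exceed what they make up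
    for. *)
Lemma exp_average_bound (E : finType) (F : {set E}) (h : E -> nat) (L : nat) :
  (0 < L)%N ->
  (\sum_(e in F) 2 ^ h e * h e <= L * \sum_(e in F) 2 ^ h e)%N ->
  {in F, forall e, (2 ^ h e <= #|F| * L * 2 ^ L)%N}.
Proof.
move=> L0 key e0 e0F.
have F0 : (0 < #|F|)%N by apply/card_gt0P; exists e0.
have [le|lt] := leqP (h e0) L.
  apply: leq_trans (leq_pmull _ _); last by rewrite muln_gt0 F0.
  by rewrite leq_exp2l.
have pt e : (L * 2 ^ h e <= 2 ^ h e * h e + L * 2 ^ L)%N.
  have [le|lt'] := leqP (h e) L.
    by apply: leq_trans (leq_addl _ _); rewrite leq_mul2l leq_exp2l // le orbT.
  by apply: leq_trans (leq_addr _ _); rewrite mulnC leq_mul2l ltnW ?orbT.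
have pt0 : (L * 2 ^ h e0 + 2 ^ h e0 <= 2 ^ h e0 * h e0)%N.
  by rewrite addnC -mulSn mulnC leq_mul2l lt orbT.
move: key; rewrite big_distrr /= (bigD1 e0) //=.
rewrite [X in (_ <= X)%N -> _](bigD1 e0) //=.
have : (\sum_(e in F | e != e0) L * 2 ^ h e <=
   \sum_(e in F | e != e0) 2 ^ h e * h e +
   \sum_(e in F | e != e0) L * 2 ^ L)%N.
  by rewrite -big_split; apply: leq_sum => e _; exact: pt.
have : (\sum_(e in F | e != e0) L * 2 ^ L <= #|F| * L * 2 ^ L)%N.
  by rewrite -mulnA -sum_nat_const [X in (_ <= X)%N](bigD1 e0) //= leq_addl.
lia.
Qed.

(** Binary codes are spaces of functions from E to the field with two elements;
    such a function stands for the set of edges where it is nonzero. *)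
Section BinaryCode.
Variable E : finType.
Local Notation vec := {ffun E -> ('F_2)^o}.
Implicit Types (F : {set E}) (Z : {vspace vec}) (x : vec) (w : E -> nat).

Definition load (s : seq vec) (e : E) : nat := (\sum_(x <- s) (x e != 0%R))%N.

Definition weight w F (s : seq vec) : nat := (\sum_(e in F) w e * load s e)%N.

Lemma load_count s e : load s e = count (fun x => x e != 0) s.
Proof.
by rewrite /load -sum1_count [RHS]big_mkcond; apply: eq_bigr => x _; case: eqP.
Qed.

Lemma weight_cons w F x s :
  weight w F (x :: s) = (\sum_(e in F) w e * (x e != 0%R) + weight w F s)%N.
Proof.
rewrite /weight -big_split; apply: eq_bigr => e _ /=.
by rewrite /load big_cons mulnDr.
Qed.

Definition has_light_bases Z F K : Prop :=
  forall w, exists2 s, basis_of Z s & (weight w F s <= K * \sum_(e in F) w e)%N.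

(** The basis is the one that minimises the sum of [2 ^ load b e] over F. *)
Lemma light_bases_congestion Z F K : has_light_bases Z F K -> (0 < K)%N ->
  exists2 s, basis_of Z s & {in F, forall e,
    (2 ^ load s e <= #|F| * (K.*2) * 2 ^ K.*2)%N}.
Proof.
move=> light K0; pose d := \dim Z.
pose Phi (b : d.-tuple vec) := (\sum_(e in F) 2 ^ load b e)%N.
pose b0 := vbasis Z : d.-tuple vec.
case: (@arg_minnP _ b0 (fun b : d.-tuple vec => basis_of Z b) Phi (vbasisP Z)).
move=> b bZ bmin; exists b => //.
pose w e := (2 ^ load b e)%N.
have [s0 s0Z ws0] := light w.
have sz : size s0 == d by case/andP: s0Z => /eqP sp; rewrite /free sp eq_sym.
pose c := Tuple sz; have cZ : basis_of Z c := s0Z.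
have loadE (t : d.-tuple vec) e : load t e = (\sum_i (tnth t i e != 0)%R)%N.
  by rewrite /load big_tuple.
have key : (\sum_(e in F) w e * load b e <= 2 * \sum_(e in F) w e * load c e)%N.
  have [p pP] := basis_exchange_perm bZ cZ.
  have one j : (\sum_(e in F) w e * (tnth b (p j) e != 0)%R
      <= 2 * \sum_(e in F) w e * (tnth c j e != 0)%R)%N.
    have := bmin _ (pP j); set b' := mktuple _ => le0.
    have le : (\sum_(e in F) w e <= \sum_(e in F) 2 ^ load b' e)%N := le0.
    have lb' e : (load b' e + (tnth b (p j) e != 0)%R
                  = load b e + (tnth c j e != 0)%R)%N.
      rewrite !loadE (bigD1 (p j)) //= [in RHS](bigD1 (p j)) //=.
      rewrite tnth_mktuple eqxx.
      under eq_bigr => i ne do rewrite tnth_mktuple (negPf ne).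
      by rewrite addnC -[RHS]addnA; congr (_ + _)%N; rewrite addnC.
    (* In units of [w e], this is an equality unless e lies both in the removed
       and in the added vector, where it reads [2 + 1 <= 2 + 2]. *)
    have pt e : (2 * 2 ^ load b' e + w e * (tnth b (p j) e != 0)%R <=
       2 * w e + 2 * (w e * (tnth c j e != 0)%R))%N.
      have := lb' e; rewrite /w.
      case: (tnth b (p j) e != 0)%R; case: (tnth c j e != 0)%R => /=;
        rewrite ?addn0 ?addn1 => h; rewrite ?h.
      - by case: h => ->; lia.
      - by rewrite -h expnS; lia.
      - by rewrite expnS; lia.
      - lia.
    have : (2 * \sum_(e in F) 2 ^ load b' e +
       \sum_(e in F) w e * (tnth b (p j) e != 0)%R <=
       2 * (\sum_(e in F) w e) + 2 * \sum_(e in F) w e * (tnth c j e != 0)%R)%N.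
      rewrite !big_distrr -!big_split /=; apply: leq_sum => e _; exact: pt.
    by move: le; clear; lia.
  have swap (t : d.-tuple vec) : (\sum_(e in F) w e * load t e =
      \sum_j \sum_(e in F) w e * (tnth t j e != 0)%R)%N.
    by rewrite exchange_big /=; apply: eq_bigr => e _; rewrite loadE big_distrr.
  rewrite !swap (reindex_inj (@perm_inj _ p)) big_distrr /=.
  by apply: leq_sum => j _; exact: one.
have {}key : (\sum_(e in F) w e * load b e <= K.*2 * \sum_(e in F) w e)%N.
  apply: leq_trans key _; rewrite -mul2n -mulnA leq_mul2l /=; exact: ws0.
by apply: exp_average_bound key; rewrite double_gt0.
Qed.
End BinaryCode.

(** * Edge vectors over the field with two elements *)

Lemma F2_cases (a : 'F_2) : a = 0 \/ a = 1.
Proof. by case: a => [[|[|//]] lt]; [left|right]; apply/val_inj. Qed.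

Lemma F2_addrr (a : 'F_2) : a + a = 0.
Proof. by case: (F2_cases a) => ->; apply/val_inj. Qed.

Lemma F2_oppr (a : 'F_2) : - a = a.
Proof. by apply/eqP; rewrite eq_sym -subr_eq0 opprK F2_addrr. Qed.

Lemma F2_cancel3 (p a b : 'F_2) : p + a + (p + b) + (a + b) = 0.
Proof. by rewrite [p + a + _]addrACA F2_addrr add0r F2_addrr. Qed.

Lemma F2_cancel4 (p a b c : 'F_2) : p + a + (p + b) + (a + c + (b + c)) = 0.
Proof. by rewrite [a + c + _]addrACA F2_addrr addr0 F2_cancel3. Qed.

Section EdgeVectors.
Variable E : finType.
Local Notation vec := {ffun E -> ('F_2)^o}.
Implicit Types (x y : vec) (e f : E) (A F : {set E}) (l : seq vec).

Definition delta e : vec := [ffun f => (f == e)%:R].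

Definition esupp x : {set E} := [set e | x e != 0].

Lemma vec_addrr x : x + x = 0.
Proof. by apply/ffunP=> e; rewrite !ffunE F2_addrr. Qed.

Lemma vec_oppr x : - x = x.
Proof. by apply/eqP; rewrite eq_sym -subr_eq0 opprK vec_addrr. Qed.

Lemma card_esuppD x y : (#|esupp (x + y)%R| <= #|esupp x| + #|esupp y|)%N.
Proof.
apply: leq_trans (leq_card_setU (esupp x) (esupp y)).1.
apply/subset_leq_card/subsetP=> e; rewrite !inE ffunE.
by apply: contraR; rewrite negb_or !negbK => /andP[/eqP -> /eqP ->]; rewrite addr0.
Qed.

Lemma esupp_delta e : esupp (delta e) = [set e].
Proof. by apply/setP=> f; rewrite !inE ffunE; case: (f == e). Qed.

Lemma esuppP F x : reflect (forall e, e \notin F -> x e = 0) (esupp x \subset F).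
Proof.
apply: (iffP subsetP) => [sF e|zF e]; last first.
  by rewrite inE; apply: contraR => /zF ->.
by apply: contraNeq => xe; apply: sF; rewrite inE.
Qed.

Lemma span_closed (P : vec -> Prop) l x :
  P 0 -> (forall a y z, P y -> P z -> P (a *: y + z)) -> {in l, forall y, P y} ->
  x \in <<l>>%VS -> P x.
Proof.
move=> P0 PD; elim: l x => [|y l IH] x lP.
  by rewrite span_nil memv0 => /eqP ->.
rewrite span_cons => /memv_addP[_ /vlineP[a ->] [z zl ->]].
apply: PD; first by apply: lP; rewrite mem_head.
by apply: IH zl => u ul; apply: lP; rewrite inE ul orbT.
Qed.

Lemma mem_span_map (h : vec -> vec) l x :
  linear h -> x \in <<l>>%VS -> h x \in <<map h l>>%VS.
Proof.
move=> hl; elim: l x => [|y l IH] x.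
  rewrite span_nil memv0 => /eqP ->.
  by have := hl 1 0 0; rewrite scaler0 addr0 scale1r vec_addrr => ->; exact: mem0v.
rewrite /= !span_cons => /memv_addP[_ /vlineP[a ->] [z zl ->]].
by rewrite hl memv_add ?IH // memvZ // memv_line.
Qed.

Lemma free_delta (es : seq E) : uniq es -> free (map delta es).
Proof.
elim: es => [|e es IH] /=; first by rewrite nil_free.
case/andP=> ne /IH; rewrite free_cons => ->; rewrite andbT.
apply/negP=> e_span; have : delta e e = 0; last by rewrite ffunE eqxx.
apply: (@span_closed (fun x => x e = 0)) e_span => [|a y z|_ /mapP[f fes ->]].
- by rewrite ffunE.
- by rewrite !ffunE => -> ->; rewrite scaler0 addr0.
- by rewrite ffunE; case: eqP => // ef; rewrite ef fes in ne.
Qed.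

(** Unit vectors are linearly independent.  This serves to count the edges
    inside a ball, each of which is a sum of two of the path vectors. *)
Lemma card_delta_span A l :
  {in A, forall e, delta e \in <<l>>%VS} -> (#|A| <= size l)%N.
Proof.
move=> Al; apply: leq_trans (dim_span l).
have /eqP : free (map delta (enum A)) by rewrite free_delta ?enum_uniq.
rewrite size_map -cardE => <-; apply/dimvS/span_subvP => _ /mapP[e eA ->].
by apply: Al; rewrite -mem_enum.
Qed.
End EdgeVectors.

(** * Cycles of a graph with varying ends and edge set *)

(** The end maps are parameters because contracting an edge changes them, while
    the types of vertices and edges stay the same. *)
Section Graph.
Variables V E : finType.
Local Notation vec := {ffun E -> ('F_2)^o}.
Implicit Types (s t : E -> V) (x y z : vec) (e f : E) (F : {set E}).
Implicit Types (u v : V) (l : seq vec).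

Definition inc s t e v : nat := (s e == v) + (t e == v).

(** This is [boundary], for end maps that are not those of a fixed multigraph. *)
Definition bd s t x v : 'F_2 := \sum_e x e * (inc s t e v)%:R.

Definition deg s t F v : nat := (\sum_(e in F) inc s t e v)%N.

Definition cycle_in s t F x : bool :=
  (esupp x \subset F) && [forall v, bd s t x v == 0].

Lemma bd_linear s t a x y v :
  bd s t (a *: x + y) v = a * bd s t x v + bd s t y v.
Proof.
rewrite /bd mulr_sumr -big_split; apply: eq_bigr => e _ /=.
by rewrite !ffunE mulrDl -mulrA.
Qed.

Lemma bdD s t x y v : bd s t (x + y) v = bd s t x v + bd s t y v.
Proof. by rewrite -[x]scale1r bd_linear mul1r scale1r. Qed.

Lemma bd0 s t v : bd s t 0 v = 0.
Proof. by apply: big1 => e _; rewrite ffunE mul0r. Qed.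

Lemma bdZ s t a x v : bd s t (a *: x) v = a * bd s t x v.
Proof. by rewrite -[_ *: _]addr0 bd_linear bd0 addr0. Qed.

Lemma bd_delta s t e v : bd s t (delta e) v = (inc s t e v)%:R.
Proof.
rewrite /bd (bigD1 e) //= ffunE eqxx mul1r big1 ?addr0 // => f ne.
by rewrite ffunE (negPf ne) mul0r.
Qed.

(** Every edge has two ends. *)
Lemma bd_sum s t x : \sum_v bd s t x v = 0.
Proof.
rewrite exchange_big big1 // => e _ /=; rewrite -mulr_sumr -natr_sum.
have -> : (\sum_v inc s t e v = 2)%N.
  have one (a : V) : (\sum_v (a == v) = 1)%N.
    by rewrite (bigD1 a) //= eqxx big1 // => v; rewrite eq_sym => /negPf ->.
  by rewrite big_split /= !one.
by apply/eqP; rewrite mulf_eq0 orbC F2_natr.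
Qed.

Lemma bd_all_but_one s t x u :
  (forall v, v != u -> bd s t x v = 0) -> forall v, bd s t x v = 0.
Proof.
move=> h v; case: (eqVneq v u) => [->|/h //].
by have := bd_sum s t x; rewrite (bigD1 u) //= big1 ?addr0.
Qed.

Lemma cycle_inP s t F x :
  reflect ((forall e, e \notin F -> x e = 0) /\ (forall v, bd s t x v = 0))
          (cycle_in s t F x).
Proof.
apply: (iffP andP) => -[/esuppP xF]; first by move/forallP=> h; split=> // v; apply/eqP.
by move=> h; split=> //; apply/forallP=> v; apply/eqP.
Qed.

Lemma cycle_in_lin s t F a x y :
  cycle_in s t F x -> cycle_in s t F y -> cycle_in s t F (a *: x + y).
Proof.
move=> /cycle_inP[xF xb] /cycle_inP[yF yb]; apply/cycle_inP; split=> [e eF|v].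
  by rewrite !ffunE xF // yF // addr0 scaler0.
by rewrite bd_linear xb yb mulr0 addr0.
Qed.
Definition cycles_on s t F : {vspace vec} := <<enum (cycle_in s t F)>>%VS.

Lemma mem_cycles_on s t F x : (x \in cycles_on s t F) = cycle_in s t F x.
Proof.
apply/idP/idP => [x_span|xF]; last by apply: memv_span; rewrite mem_enum.
apply: (@span_closed _ (cycle_in s t F)) x_span => [|a y z|y]; last by rewrite mem_enum.
  by apply/cycle_inP; split=> [e _|v]; rewrite ?ffunE ?bd0.
exact: cycle_in_lin.
Qed.
End Graph.

(** * Short cycles in graphs of minimum degree three *)

Section ShortCycle.
Variables V E : finType.
Local Notation vec := {ffun E -> ('F_2)^o}.
Variables (s t : E -> V) (F : {set E}) (k : nat).
Implicit Types (x : vec) (B : {set V}) (X : V -> vec).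

(** The vector [X u] plays the role of a path from [v0] to [u] inside B with at
    most i edges.  Only its size, support and boundary enter the argument, so it
    is kept as a vector rather than as a walk. *)
Definition path_ball (v0 : V) (i : nat) B X : Prop :=
  forall u, u \in B ->
    [/\ (#|esupp (X u)| <= i)%N,
        forall e, X u e != 0 -> [/\ e \in F, s e \in B & t e \in B]
      & forall v, bd s t (X u) v = (v0 == v)%:R + (u == v)%:R].

Hypothesis girth : forall x, cycle_in s t F x -> (#|esupp x| <= k.*2)%N -> x = 0.

(** The sum of the paths to a and b and of the edge e is a short cycle. *)
Lemma path_ball_close v0 i B X a b e :
  path_ball v0 i B X -> (i < k)%N -> a \in B -> b \in B -> e \in F ->
  (forall v, (inc s t e v = (a == v) + (b == v))%N) -> delta e = X a + X b.
Proof.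
move=> ball ik aB bB eF ie.
have [ca sa da] := ball a aB; have [cb sb db] := ball b bB.
have : X a + X b + delta e = 0.
  apply: girth.
    apply/cycle_inP; split=> [f fF|v]; last first.
      rewrite !bdD bd_delta da db ie natrD.
      exact: F2_cancel3.
    rewrite !ffunE; have /negPf-> : f != e by apply: contraNneq fF => ->.
    have /eqP -> : X a f == 0 by apply: contraNT fF => /sa[].
    have /eqP -> : X b f == 0 by apply: contraNT fF => /sb[].
    by rewrite !addr0.
  apply: leq_trans (card_esuppD _ _) _.
  rewrite esupp_delta cards1.
  have := card_esuppD (X a) (X b); lia.
by move/eqP; rewrite addr_eq0 vec_oppr => /eqP ->.
Qed.

Lemma sum_deg B :
  (\sum_(b in B) deg s t F b = \sum_(e in F) ((s e \in B) + (t e \in B)))%N.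
Proof.
rewrite exchange_big; apply: eq_bigr => e _; rewrite big_split /=.
have one a : (\sum_(b in B) (a == b) = (a \in B))%N.
  case aB: (a \in B); last first.
    by apply: big1 => b bB; case: eqP => // ab; rewrite ab bB in aB.
  by rewrite (bigD1 a) //= eqxx big1 // => b /andP[_]; rewrite eq_sym => /negPf ->.
by rewrite !one.
Qed.

Hypothesis deg3 : forall v, (deg s t F v != 0 -> 3 <= deg s t F v)%N.

(** There are at most [#|B|] edges inside B, as each of their unit vectors is a
    sum of two of the [X b].  With degrees at least 3, at least [#|B|] edges
    leave B, and they reach distinct vertices since two edges with the same outer
    end would close a short cycle. *)
Lemma path_ball_grow v0 i B X :
  path_ball v0 i B X -> (i < k)%N -> (forall b, b \in B -> deg s t F b != 0%N) ->
  exists B' X', [/\ path_ball v0 i.+1 B' X', (#|B|.*2 <= #|B'|)%N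
                  & forall b, b \in B' -> deg s t F b != 0%N].
Proof.
move=> ball ik degB.
pose Ein := [set e in F | (s e \in B) && (t e \in B)].
pose Eout := [set e in F | (s e \in B) (+) (t e \in B)].
pose ie e := if s e \in B then s e else t e.
pose oe e := if s e \in B then t e else s e.
have few_inner : (#|Ein| <= #|B|)%N.
  rewrite (cardE B) -(size_map X); apply: card_delta_span => e.
  rewrite inE => /and3P[eF sB tB].
  rewrite (path_ball_close ball ik sB tB eF) //.
  by apply: memvD; apply/memv_span/map_f; rewrite mem_enum.
have many_outer : (#|B| <= #|Eout|)%N.
  have : (3 * #|B| <= \sum_(b in B) deg s t F b)%N.
    by rewrite mulnC -sum_nat_const; apply: leq_sum => b /degB /deg3.
  have -> : (\sum_(b in B) deg s t F b = 2 * #|Ein| + #|Eout|)%N.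
    rewrite sum_deg -!sum1_card [LHS]big_mkcond [X in (2 * X)%N]big_mkcond.
    rewrite [X in (_ + X)%N]big_mkcond big_distrr -big_split /=.
    apply: eq_bigr => e _; rewrite !inE.
    by case: (e \in F); case: (s e \in B); case: (t e \in B).
  lia.
have outP e : e \in Eout -> [/\ e \in F, ie e \in B, oe e \notin B
     & forall v, inc s t e v = ((ie e == v) + (oe e == v))%N].
  rewrite inE /ie /oe => /andP[eF]; rewrite /inc.
  case sB: (s e \in B); case tB: (t e \in B) => //= _; rewrite ?sB ?tB; split=> // v.
  exact: addnC.
have oe_inj : {in Eout &, injective oe}.
  move=> e f eO fO oef; apply: contraTeq isT => ef.
  have [eF ieB oeB incE] := outP e eO; have [fF ifB ofB incF] := outP f fO.
  have [ca sa da] := ball _ ieB; have [cb sb db] := ball _ ifB.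
  pose x := X (ie e) + X (ie f) + (delta e + delta f).
  (* The edge e leaves B, while the paths stay inside. *)
  have xe : x e = 1.
    rewrite !ffunE eqxx (negPf ef) addr0.
    have out (g : V) : g \in B -> X g e = 0.
      move=> gB; have [_ sg _] := ball _ gB; apply/eqP.
      apply: contraNT oeB => /sg[_ sB tB]; rewrite /oe; by case: ifP.
    by rewrite !out // !add0r.
  suff x0 : x = 0 by move: xe; rewrite x0 ffunE => /eqP.
  apply: girth.
    apply/cycle_inP; split=> [g gF|v]; last first.
      rewrite !bdD !bd_delta da db incE incF oef !natrD.
      exact: F2_cancel4.
    rewrite !ffunE.
    have /negPf-> : g != e by apply: contraNneq gF => ->.
    have /negPf-> : g != f by apply: contraNneq gF => ->.
    have /eqP -> : X (ie e) g == 0 by apply: contraNT gF => /sa[].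
    have /eqP -> : X (ie f) g == 0 by apply: contraNT gF => /sb[].
    by rewrite !addr0.
  apply: leq_trans (card_esuppD _ _) _.
  have := card_esuppD (X (ie e)) (X (ie f)).
  have := card_esuppD (delta e) (delta f); rewrite !esupp_delta !cards1.
  move: ca cb ik; clear; lia.
pose N := oe @: Eout.
have disj : [disjoint B & N].
  rewrite disjoint_sym; apply/pred0P => u /=; apply/andP => -[/imsetP[e eO ->]].
  by have [_ _ /negPf->] := outP e eO.
pose X' u := if u \in B then X u else
  if [pick e in Eout | oe e == u] is Some e then X (ie e) + delta e else 0.
exists (B :|: N), X'; split.
- move=> u; rewrite inE /X'; case uB: (u \in B) => /=.
    move=> _; have [cu su du] := ball u uB; split=> //; first exact: leqW.
    by move=> e /su[eF sB tB]; rewrite !inE sB tB.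
  move=> uN; case: pickP => [e /andP[eO /eqP oeu]|none]; last first.
    by case/imsetP: uN => e eO ue; have := none e; rewrite eO ue eqxx.
  have [eF ieB oeB incE] := outP e eO; have [ca sa da] := ball _ ieB.
  split.
  + apply: leq_trans (card_esuppD _ _) _; rewrite esupp_delta cards1; lia.
  + move=> g; case: (eqVneq g e) => [-> _|ge].
      split=> //; rewrite !inE.
        move: ieB uN; rewrite -oeu /ie /oe.
        by case sB: (s e \in B) => //= tB ->; rewrite orbT.
      move: ieB uN; rewrite -oeu /ie /oe.
      by case sB: (s e \in B) => //= tB; rewrite ?tB // => ->; rewrite orbT.
    by rewrite !ffunE (negPf ge) addr0 => /sa[gF sB tB]; rewrite !inE sB tB.
  + move=> v; rewrite bdD bd_delta da incE oeu natrD addrA.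
    by rewrite -[X in X + _]addrA F2_addrr addr0.
- rewrite cardsU; have /eqP -> : B :&: N == set0 by rewrite setI_eq0.
  rewrite cards0 subn0 card_in_imset // -addnn leq_add2l //.
- move=> b; rewrite inE => /orP[/degB //|/imsetP[e eO ->]].
  have [eF _ _ incE] := outP e eO.
  rewrite /deg (bigD1 e) //= incE eqxx; lia.
Qed.

(** The Moore bound: the ball of radius k has at least 2^k vertices. *)
Lemma vertices_ge_exp v0 : deg s t F v0 != 0%N -> (2 ^ k <= #|V|)%N.
Proof.
move=> d0.
suff [B [X [_ B2 _]]] : exists B X, [/\ path_ball v0 k B X, (2 ^ k <= #|B|)%N
   & forall b, b \in B -> deg s t F b != 0%N].
  exact: leq_trans B2 (max_card _).
have : (k <= k)%N by []; elim: {1 3 4}k => [|i IH] ik.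
  exists [set v0], (fun=> 0); rewrite cards1; split=> // u; rewrite inE => /eqP ->//.
  split=> [|e|v].
  - by rewrite leqn0 cards_eq0; apply/eqP/setP=> e; rewrite !inE ffunE eqxx.
  - by rewrite ffunE eqxx.
  - by rewrite bd0 F2_addrr.
have [B [X [ball B2 dB]]] := IH (ltnW ik).
have [B' [X' [ball' B2' dB']]] := path_ball_grow ball ik dB.
exists B', X'; split=> //; rewrite expnS mul2n; apply: leq_trans B2'.
by rewrite leq_double.
Qed.
End ShortCycle.

(** * Cycle bases of small weight *)

Section LightCycles.
Variables (V E : finType) (k : nat).
Hypothesis vertices_lt : (#|V| < 2 ^ k)%N.
Local Notation vec := {ffun E -> ('F_2)^o}.
Implicit Types (s t : E -> V) (w : E -> nat) (F : {set E}) (l : seq vec).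

Definition light_family s t F w l : Prop :=
  [/\ {in l, forall x, cycle_in s t F x},
      forall z, cycle_in s t F z -> z \in <<l>>%VS
    & (weight w F l <= k.*2 * \sum_(e in F) w e)%N].

Lemma cycle_inW s t F F' x :
  F' \subset F -> cycle_in s t F' x -> cycle_in s t F x.
Proof. by move=> FF' /andP[xF' xb]; rewrite /cycle_in xb (subset_trans xF'). Qed.

Lemma load_cycles0 s t F l e :
  {in l, forall x, cycle_in s t F x} -> e \notin F -> load l e = 0%N.
Proof.
move=> lF eF; rewrite /load big_seq big1 // => x /lF/cycle_inP[xF _].
by rewrite xF // eqxx.
Qed.

(** The heaviest edge e of the short cycle c pays for c, and adding c moves any
    cycle through e off it. *)
Lemma light_family_short_cycle s t F w (c : vec) :
  cycle_in s t F c -> c != 0 -> (#|esupp c| <= k.*2)%N ->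
  (forall F', (#|F'| < #|F|)%N -> exists l, light_family s t F' w l) ->
  exists l, light_family s t F w l.
Proof.
move=> cF c0 ck IH.
have [e0 e0c] : exists e, e \in esupp c.
  apply/set0Pn; apply: contraNneq c0 => c0; apply/eqP/ffunP => e; rewrite ffunE.
  by apply/eqP; move/setP/(_ e): c0; rewrite !inE => /negbFE.
case: (@arg_maxnP _ e0 (mem (esupp c)) w e0c) => e /= ec wmax.
have csub : esupp c \subset F by case/andP: cF.
have eF : e \in F by apply: (subsetP csub).
have [l [lF lspan lw]] := IH (F :\ e) (proper_card (properD1 eF)).
have ce : c e = 1 by move: ec; rewrite inE; case: (F2_cases (c e)) => ->.
exists (c :: l); split.
- move=> x; rewrite inE => /orP[/eqP-> //|/lF].
  by apply: cycle_inW; apply: subsetDl.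
- move=> z zF; rewrite span_cons.
  have -> : z = z e *: c + (z - z e *: c) by rewrite addrC subrK.
  apply: memv_add; first by rewrite memvZ // memv_line.
  apply: lspan; have /cycle_inP[xF xb] : cycle_in s t F (- z e *: c + z).
    exact: cycle_in_lin.
  rewrite addrC -scaleNr; apply/cycle_inP; split=> // f.
  rewrite !inE negb_and negbK => /orP[/eqP->|/xF //].
  by rewrite !ffunE ce /GRing.scale /= mulr1 addNr.
- have -> : (weight w F (c :: l) =
     \sum_(g in esupp c) w g + weight w (F :\ e) l)%N.
    have -> : weight w (F :\ e) l = weight w F l.
      rewrite /weight [RHS](big_setD1 e eF) /= (load_cycles0 lF) ?muln0 ?add0n //.
      by rewrite !inE eqxx.
    rewrite weight_cons; congr addn; rewrite [LHS]big_mkcond [RHS]big_mkcond /=.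
    apply: eq_bigr => g _; rewrite inE; case: eqP => [_|/eqP cg] /=.
      by rewrite muln0 if_same.
    by rewrite muln1 (subsetP csub) // inE.
  have : (\sum_(g in esupp c) w g <= k.*2 * w e)%N.
    apply: leq_trans (leq_mul ck (leqnn (w e))).
    by rewrite -sum_nat_const; apply: leq_sum => g /wmax.
  by rewrite (big_setD1 e eF) /= mulnDr => ce_le; apply: leq_add.
Qed.

(** Contracting f = uv into u leaves a cycle space isomorphic to the original
    one: a cycle of the contracted graph may only fail to be balanced at u and
    v, and then f is to be added.  The vector obtained uses f only if it uses
    another edge at v.  There is at most one such edge, so it can take over the
    weight of f. *)
Lemma light_family_contract s t F w f v :
  f \in F -> s f != t f -> inc s t f v != 0%N -> (deg s t F v <= 2)%N ->
  (forall s' t' F' w', (#|F'| < #|F|)%N -> exists l, light_family s' t' F' w' l) ->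
  exists l, light_family s t F w l.
Proof.
move=> fF nloop fv deg2 IH.
pose u := if s f == v then t f else s f.
have uv : u != v.
  by rewrite /u; case: (s f =P v) => [<-|/eqP //]; rewrite eq_sym.
have incf y : inc s t f y = ((v == y) + (u == y))%N.
  rewrite /u; move: fv; rewrite /inc.
  by case: (s f =P v) => [->//|_] /=; case: (t f =P v) => // -> _; rewrite addnC.
have incfv : inc s t f v = 1%N by rewrite incf eqxx (negPf uv).
have incfy y : y != v -> y != u -> inc s t f y = 0%N.
  by move=> yv yu; rewrite incf eq_sym (negPf yv) eq_sym (negPf yu).
pose c y := if y == v then u else y.
pose s' e := c (s e); pose t' e := c (t e).
have cv y : (c y == v) = false.
  by rewrite /c; case: ifP => // _; rewrite (negPf uv).
have cy a y : y != v -> y != u -> (c a == y) = (a == y).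
  rewrite /c => yv yu; case: (a =P v) => // ->.
  by rewrite eq_sym (negPf yu) eq_sym (negPf yv).
have bd'v x : bd s' t' x v = 0.
  by rewrite /bd big1 // => e _; rewrite /inc !cv mulr0.
have bd'y x y : y != v -> y != u -> bd s' t' x y = bd s t x y.
  by move=> yv yu; rewrite /bd; apply: eq_bigr => e _; rewrite /inc !cy.
pose F' := F :\ f.
pose w' e := (w e + w f * inc s t e v)%N.
have [l [lF lspan lw]] := IH s' t' F' w' (proper_card (properD1 fF)).
pose ext (x : vec) : vec := x + bd s t x v *: delta f.
have ext_lin : linear ext.
  move=> a x y; rewrite /ext bd_linear scalerDl -scalerA scalerDr.
  by rewrite addrACA.
exists (map ext l); split.
- move=> _ /mapP[x /lF/cycle_inP[xF' xb] ->]; apply/cycle_inP; split.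
    move=> e eF; rewrite !ffunE xF'; last by rewrite !inE (negPf eF) andbF.
    have /negPf-> : e != f by apply: contraNneq eF => ->.
    by rewrite scaler0 addr0.
  (* Balance at u follows from balance at all the other vertices. *)
  apply: (@bd_all_but_one _ _ _ _ _ u) => y yu; rewrite bdD bdZ bd_delta.
  case: (eqVneq y v) => [->|yv]; first by rewrite incfv mulr1 F2_addrr.
  by rewrite incfy // mulr0 addr0 -bd'y.
- move=> z /cycle_inP[zF zb]; pose z' : vec := z - z f *: delta f.
  have -> : z = ext z'.
    have bz' : bd s t z' v = z f.
      by rewrite /z' bdD -scaleNr bdZ bd_delta zb add0r incfv mulr1 F2_oppr.
    by rewrite /ext bz' subrK.
  apply: mem_span_map => //; apply: lspan; apply/cycle_inP; split.
    move=> e; rewrite !inE negb_and negbK /z' => /orP[/eqP->|eF].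
      by rewrite !ffunE eqxx /GRing.scale /= mulr1 subrr.
    have /negPf ef : e != f by apply: contraNneq eF => ->.
    by rewrite !ffunE ef (zF e eF) scaler0 subr0.
  apply: (@bd_all_but_one _ _ _ _ _ u) => y yu.
  case: (eqVneq y v) => [->|yv] //.
  by rewrite bd'y // /z' bdD -scaleNr bdZ bd_delta zb incfy // mulr0 addr0.
have load_ext e : e != f -> load (map ext l) e = load l e.
  move=> ef; rewrite /load big_map; apply: eq_bigr => x _.
  by rewrite !ffunE (negPf ef) scaler0 addr0.
have load_f : (load (map ext l) f <= \sum_(e in F') inc s t e v * load l e)%N.
  rewrite /load big_map big_seq.
  under [X in (_ <= X)%N]eq_bigr => e _ do rewrite big_distrr big_seq /=.
  rewrite exchange_big /=; apply: leq_sum => x xl.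
  have /cycle_inP[xF _] := lF _ xl.
  rewrite !ffunE eqxx xF ?inE ?eqxx // add0r /GRing.scale /= mulr1.
  case: eqP => //= /eqP b0; rewrite lt0n; apply: contraNneq b0 => /eqP.
  rewrite sum_nat_eq0 => /forallP h; apply/eqP; apply: big1 => e _.
  have := h e; case eF': (e \in F') => /=; last by rewrite xF ?eF' // mul0r.
  rewrite muln_eq0 => /orP[/eqP->|]; rewrite ?mulr0 //.
  by rewrite eqb0 negbK => /eqP->; rewrite mul0r.
have big_f (g : E -> nat) : (\sum_(e in F) g e = g f + \sum_(e in F') g e)%N.
  exact: big_setD1.
have deg1 : (\sum_(e in F') inc s t e v <= 1)%N.
  by move: deg2; rewrite /deg big_f incfv.
have wl : (weight w F (map ext l) <= weight w' F' l)%N.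
  rewrite /weight big_f.
  have -> : (\sum_(e in F') w' e * load l e =
      w f * (\sum_(e in F') inc s t e v * load l e)
      + \sum_(e in F') w e * load l e)%N.
    rewrite big_distrr -big_split; apply: eq_bigr => e _ /=.
    by rewrite /w' mulnDl mulnA addnC.
  apply: leq_add; first by rewrite leq_mul2l load_f orbT.
  by apply: leq_sum => e; rewrite !inE => /andP[ef _]; rewrite load_ext.
apply: leq_trans wl _; apply: leq_trans lw _; rewrite leq_mul2l; apply/orP; right.
rewrite big_f /w' big_split -big_distrr /= addnC leq_add2r.
by rewrite -[X in (_ <= X)%N]muln1 leq_mul2l deg1 orbT.
Qed.

(** The end maps and weights vary in the induction on the number of edges, since
    contraction changes them. *)
Lemma exists_light_family s t F w : exists l, light_family s t F w l.
Proof.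
elim: {F}_.+1 {-2}F (ltnSn #|F|) s t w => // m IHm F Fm s t w.
have IH s' t' F' w' : (#|F'| < #|F|)%N -> exists l, light_family s' t' F' w' l.
  by move=> lt; apply: IHm; apply: leq_trans lt _.
case: (boolP [exists c : vec, [&& cycle_in s t F c, c != 0 & (#|esupp c| <= k.*2)%N]]).
  case/existsP=> c /and3P[cF c0 ck].
  by apply: light_family_short_cycle cF c0 ck _ => F'; apply: IH.
move/existsPn=> noshort.
have girth (x : vec) : cycle_in s t F x -> (#|esupp x| <= k.*2)%N -> x = 0.
  by move=> xF xk; have := noshort x; rewrite xF xk andbT /= negbK => /eqP.
case: (boolP [exists v, (0 < deg s t F v < 3)%N]).
  case/existsP=> v /andP[dv0 dv3].
  have [f fF fv] : exists2 f, f \in F & inc s t f v != 0%N.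
    move: dv0; rewrite lt0n /deg sum_nat_eq0 => /forallPn[f].
    by rewrite negb_imply => /andP[]; exists f.
  apply: (@light_family_contract s t F w f v fF _ fv dv3 IH).
  (* A loop would be a cycle of length one. *)
  apply/eqP => loop.
  have /ffunP/(_ f) : delta f = 0 :> vec.
    apply: girth.
      apply/cycle_inP; split=> [e eF|y].
        by rewrite ffunE; case: eqP => // ef; rewrite ef fF in eF.
      by rewrite bd_delta /inc loop natrD F2_addrr.
    rewrite esupp_delta cards1 double_gt0 lt0n; apply: contraTneq vertices_lt => ->.
    by rewrite -leqNgt; apply/card_gt0P; exists v.
  by rewrite !ffunE eqxx => /eqP.
move/existsPn=> nodeg.
have deg3 v : (deg s t F v != 0 -> 3 <= deg s t F v)%N.
  by move=> d0; have := nodeg v; rewrite lt0n d0 /= -leqNgt.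
exists [::].
have F0 : F = set0.
  apply/eqP; apply: contraTT vertices_lt => /set0Pn[f fF]; rewrite -leqNgt.
  apply: (vertices_ge_exp girth deg3 (v0 := s f)).
  by rewrite /deg (bigD1 f) //= /inc eqxx.
rewrite F0; split=> //; last by rewrite /weight big_set0.
move=> z /cycle_inP[z0 _]; rewrite span_nil memv0; apply/eqP/ffunP=> e.
by rewrite ffunE z0 ?inE.
Qed.

Lemma cycles_on_light_bases s t F :
  has_light_bases (cycles_on s t F) F k.*2.
Proof.
move=> w; have [l [lF lspan lw]] := exists_light_family s t F w.
have [u [ul fu eu]] := span_free_subseq l.
exists u.
  rewrite /basis_of fu andbT eu eqEsubv; apply/andP; split.
    by apply/span_subvP => x /lF; rewrite mem_cycles_on.
  by apply/subvP => x; rewrite mem_cycles_on => /lspan.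
apply: leq_trans lw; apply: leq_sum => e _; rewrite leq_mul2l; apply/orP; right.
by rewrite !load_count; apply: leq_count_subseq.
Qed.
End LightCycles.

(** * Parallel edges and the basis number *)

Section BasisNumber.
Variable G : multigraph.
Local Notation V := (vertex G).
Local Notation E := (edge G).
Local Notation vec := {ffun E -> ('F_2)^o}.
Local Notation s := (@src G).
Local Notation t := (@tgt G).
Implicit Types (e f : E) (x z : vec).

Lemma mem_cycle_spaceP x :
  reflect (forall v, bd s t x v = 0) (x \in cycle_space G).
Proof.
have -> : (x \in cycle_space G) = (boundary (x : edge_space G) == 0).
  by rewrite -[x](@suppK G) mem_cycle_space boundary_charvec.
apply: (iffP eqP) => [/ffunP h v|h]; first by have := h v; rewrite !ffunE.
by apply/ffunP=> v; rewrite !ffunE; exact: h.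
Qed.

(** A spanning family suffices, because passing to a basis contained in it only
    lowers the charges. *)
Lemma basis_number_le_load (l : seq vec) N :
  <<l>>%VS = cycle_space G -> (forall e, (load l e <= N)%N) ->
  (basis_number G <= N)%N.
Proof.
move=> lZ lN; have [u [ul fu eu]] := span_free_subseq l.
have uZ : basis_of (cycle_space G) u by rewrite /basis_of fu eu lZ eqxx.
pose BB := [set @supp G x | x in u].
have bBB : cycle_basis BB.
  rewrite /cycle_basis (perm_basis (Y := u)) //; apply: uniq_perm.
  - by rewrite map_inj_uniq ?enum_uniq //; exact: can_inj (@charvecK G).
  - exact: free_uniq fu.
  move=> x; apply/imageP/idP => [[_ /imsetP[y yu ->] ->]|xu].
    by rewrite suppK.
  by exists (supp x); rewrite ?suppK //; apply: imset_f.
have congN : (congestion BB <= N)%N.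
  apply/bigmax_leqP => e _; apply: leq_trans (lN e).
  apply: (@leq_trans (load u e)); last first.
    by rewrite !load_count; apply: leq_count_subseq.
  rewrite load_count -size_filter /charge.
  have sub : [set B in BB | e \in B] \subset
      [seq @supp G x | x <- [seq x : vec <- u | x e != 0]].
    apply/subsetP => B; rewrite inE => /andP[/imsetP[x xu ->]].
    by rewrite inE => xe; apply: map_f; rewrite mem_filter xe.
  apply: leq_trans (subset_leq_card sub) _.
  by apply: leq_trans (card_size _) _; rewrite size_map.
rewrite /basis_number; case: ex_minnP => m _ mmin; apply: leq_trans congN.
by apply: mmin; apply/existsP; exists BB; rewrite bBB eqxx.
Qed.

Definition ends e : {set V} := [set s e; t e].

Definition parallels e : seq E := enum [pred f | ends f == ends e].

(** A permutation of the edges whose orbits are the parallel classes. *)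
Definition next_parallel e : E := next (parallels e) e.

Definition parallel_rep e : E := head e (parallels e).

Definition simple_part : {set E} := [set e | parallel_rep e == e].

Lemma mem_parallels e f : (f \in parallels e) = (ends f == ends e).
Proof. by rewrite mem_enum. Qed.

Lemma eq_parallels e f : ends e = ends f -> parallels e = parallels f.
Proof. by rewrite /parallels => ->. Qed.

Lemma inc_ends e f v : ends e = ends f -> inc s t e v = inc s t f v.
Proof.
move/setP=> h; have := h (s e); have := h (t e); have := h (s f); have := h (t f).
rewrite !inE !eqxx ?orbT /= /inc.
move: (s e) (t e) (s f) (t f) => a b c d.
by do 2![case/orP=> /eqP ?]; do 2![case/esym/orP=> /eqP ?]; subst; rewrite // addnC.
Qed.

Lemma ends_next_parallel e : ends (next_parallel e) = ends e.
Proof. by apply/eqP; rewrite -mem_parallels mem_next mem_parallels. Qed.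

Lemma next_parallel_inj : injective next_parallel.
Proof.
move=> e f ef; have eef : ends e = ends f.
  by rewrite -ends_next_parallel ef ends_next_parallel.
move: ef; rewrite /next_parallel (eq_parallels eef).
exact: can_inj (prev_next (enum_uniq _)) _ _.
Qed.

Lemma ends_parallel_rep e : ends (parallel_rep e) = ends e.
Proof.
apply/eqP; rewrite -mem_parallels /parallel_rep.
have : e \in parallels e by rewrite mem_parallels.
by case: (parallels e) => //= f p _; rewrite mem_head.
Qed.

Lemma eq_parallel_rep e f : ends e = ends f -> parallel_rep e = parallel_rep f.
Proof.
move=> ef; rewrite /parallel_rep (eq_parallels ef).
have : f \in parallels f by rewrite mem_parallels.
by case: (parallels f).
Qed.

Lemma parallel_rep_simple e : parallel_rep e \in simple_part.
Proof. by rewrite inE; apply/eqP/eq_parallel_rep/ends_parallel_rep. Qed.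

Lemma card_simple_part : (#|simple_part| <= #|V| * #|V|)%N.
Proof.
rewrite -card_prod -(@card_in_imset _ _ (fun e => (s e, t e))); first exact: max_card.
move=> e f; rewrite !inE => /eqP re /eqP rf [se te].
by rewrite -re -rf; apply: eq_parallel_rep; rewrite /ends se te.
Qed.

(** Each edge paired with its successor in its parallel class.  Joining all of
    them to a common representative would generate the same space, but with
    unbounded charge on the representative.  For an edge without parallels the
    vector is 0. *)
Definition digons : seq vec := [seq delta e + delta (next_parallel e) | e : E].

Lemma load_digons e : (load digons e <= 2)%N.
Proof.
have inj1 (h : E -> E) : injective h -> (\sum_f (h f == e) <= 1)%N.
  move=> hi; case: (pickP (fun f => h f == e)) => [f /eqP hf|none].
    rewrite (bigD1 f) //= hf eqxx big1 // => g gf.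
    by rewrite -hf (inj_eq hi) (negPf gf).
  by rewrite big1 // => f _; rewrite none.
rewrite /load big_image /=.
apply: leq_trans (leq_add (inj1 id (@inj_id _)) (inj1 _ next_parallel_inj)).
rewrite -big_split; apply: leq_sum => f _.
by rewrite !ffunE ![e == _]eq_sym; case: (f == e); case: (_ == e).
Qed.

Lemma digon_mem e f : ends e = ends f -> delta e + delta f \in <<digons>>%VS.
Proof.
move=> ef; pose p := parallels e.
have ep : e \in p by rewrite mem_parallels.
have fp : f \in p by rewrite mem_parallels ef.
have : fconnect (next p) e f.
  by rewrite (fconnect_cycle (cycle_next (enum_uniq _))).
move/iter_findex; set i := findex _ _ _ => <-; elim: i => [|i IH] /=.
  by rewrite vec_addrr mem0v.
set g := iter i _ e in IH *.
have gp : g \in p by rewrite /g; elim: (i) => //= j; rewrite mem_next.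
have -> : next p g = next_parallel g.
  by rewrite /next_parallel (@eq_parallels g e) //; apply/eqP; rewrite -mem_parallels.
rewrite -[delta e](addrK (delta g)) vec_oppr -addrA memvD //.
by apply/memv_span/image_f.
Qed.

Lemma digon_cycle e f : ends e = ends f -> delta e + delta f \in cycle_space G.
Proof.
move=> ef; apply/mem_cycle_spaceP => v.
by rewrite bdD !bd_delta (inc_ends v ef) F2_addrr.
Qed.

(** Adding the pairs made of e and its representative, over the edges e of a
    cycle, moves the cycle onto the representatives. *)
Lemma cycle_space_split :
  cycle_space G = (cycles_on s t simple_part + <<digons>>)%VS.
Proof.
apply/eqP; rewrite eqEsubv subv_add; apply/andP; split; last first.
  apply/andP; split.
    apply/subvP => x; rewrite mem_cycles_on => /cycle_inP[_ xb].
    exact/mem_cycle_spaceP.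
  apply/span_subvP => _ /imageP[e _ ->]; apply: digon_cycle.
  by rewrite ends_next_parallel.
apply/subvP => z /mem_cycle_spaceP zb.
have zE : z = \sum_e z e *: delta e.
  apply/ffunP => f; rewrite sum_ffunE (bigD1 f) //= big1 => [|e ef].
    by rewrite !ffunE eqxx /GRing.scale /= mulr1 addr0.
  by rewrite !ffunE eq_sym (negPf ef) scaler0.
pose y : vec := \sum_e z e *: delta (parallel_rep e).
have dE : \sum_e z e *: (delta e + delta (parallel_rep e)) = z + y.
  rewrite [X in _ = X + _]zE -big_split; apply: eq_bigr => e _.
  exact: scalerDr.
rewrite -[z](addrK y) vec_oppr -dE addrC.
apply: memv_add; last first.
  apply: memv_suml => e _; apply/memvZ/digon_mem.
  by rewrite ends_parallel_rep.
rewrite mem_cycles_on; apply/cycle_inP; split=> [f fF|v].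
  rewrite sum_ffunE big1 // => e _; rewrite !ffunE.
  case: eqP => [fe|_]; last exact: scaler0.
  by rewrite fe parallel_rep_simple in fF.
have bdsum (h : E -> vec) : bd s t (\sum_e z e *: h e) v = \sum_e z e * bd s t (h e) v.
  rewrite (big_morph (fun x => bd s t x v) (fun x x' => bdD s t x x' v) (bd0 s t v)).
  by apply: eq_bigr => e _; rewrite bdZ.
have z_sum := bdsum (@delta E); rewrite -zE zb in z_sum.
rewrite [LHS](bdsum (fun e => delta (parallel_rep e))) [RHS]z_sum.
apply: eq_bigr => e _.
by rewrite !bd_delta (inc_ends v (ends_parallel_rep e)).
Qed.

Lemma basis_number_le k :
  (0 < k)%N -> (#|V| < 2 ^ k)%N -> (basis_number G <= 7 * k + 4)%N.
Proof.
move=> k_gt0 Vk; have K0 : (0 < k.*2)%N by rewrite double_gt0.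
have [b bZ bF] :=
  light_bases_congestion (cycles_on_light_bases Vk s t simple_part) K0.
apply: (@basis_number_le_load (b ++ digons)).
  by rewrite span_cat (span_basis bZ) cycle_space_split.
move=> e; rewrite /load big_cat /= -/(load b e) -/(load digons e).
have -> : (7 * k + 4 = 7 * k + 2 + 2)%N by rewrite -addnA.
apply: leq_add (load_digons e).
case: (boolP (e \in simple_part)) => eF; last first.
  rewrite (load_cycles0 (s := s) (t := t) (F := simple_part)) // => x xb.
  by rewrite -mem_cycles_on; apply: (basis_mem bZ).
rewrite -(@leq_exp2l 2) //; apply: leq_trans (bF e eF) _.
(* The three parts of the exponent bound [#|simple_part|], [4 * k] and
   [2 ^ (4 * k)]. *)
have -> : (7 * k + 2 = (k + k) + (k + 2) + 4 * k)%N by lia.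
have -> : (k.*2.*2 = 4 * k)%N by lia.
rewrite !expnD; apply: leq_mul => //; apply: leq_mul.
  by apply: leq_trans card_simple_part _; apply: leq_mul; apply: ltnW.
by rewrite mulnC leq_mul2r (ltnW (ltn_expl _ _)) ?orbT.
Qed.
End BasisNumber.

Theorem theorem1p1 (R : realType) :
  exists C : R, forall G : multigraph, (2 <= #|vertex G|)%N ->
    (basis_number G)%:R <= C * log2 (#|vertex G|%:R : R).
Proof.
(* With j the integer part of log n, [7 * (j + 1) + 4 <= 18 * j] as [1 <= j]. *)
exists 18%:R => G n2; set n := #|vertex G| in n2 *.
have /andP[jn nj] := trunc_log_bounds (ltnSn 1) (ltnW n2).
set j := trunc_log 2 n in jn nj.
have j1 : (1 <= j)%N by rewrite -ltnS -(@ltn_exp2l 2) //; apply: leq_trans nj.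
have ln2 : 0 < ln 2 :> R by rewrite ln_gt0 // ltr1n.
apply: (@le_trans _ _ (18 * j)%:R).
  rewrite ler_nat; apply: leq_trans (basis_number_le _ nj) _; lia.
rewrite natrM ler_wpM2l // /log2 ler_pdivlMr // mulr_natl -lnXn ?ltr0n //.
rewrite ler_ln ?posrE ?exprn_gt0 ?ltr0n //; last exact: ltnW.
by rewrite -natrX ler_nat.
Qed.
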